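(* Let $X_1,\dots,X_n\in\mathbb{R}^p$ be independent random vectors satisfying the standing assumptions listed in the context, let $D$ be a deterministic $n\times n$ diagonal matrix with positive diagonal entries $R_1,\dots,R_n$, and let $A$ be a deterministic positive definite $p\times p$ matrix with $A\succeq t\,\mathrm{Id}_p$ for some $t>0$. For deterministic vectors $\alpha\in\mathbb{R}^n$ and $x\in\mathbb{R}^p$ with $\|\alpha\|=\|x\|=1$ let $$h(\alpha;X)=n^{-1/2}\alpha^\top DX\left(\frac{X^\top D^2X}{n}+A\right)^{-1}x .$$ Then, for a numerical constant $K$, $$\mathbb{E}\Big[\big(h(\alpha;X)-\mathbb{E}h(\alpha;X)\big)^2\Big]\le K\sum_{i=1}^n\left[\left(\frac1n\alpha_i^2R_i^2\,b_L(2;X_i)\frac{x^\top A^{-1}x}{t}+\frac1{n^2}R_i^4\,b_L(4;X_i)\frac{x^\top A^{-1}x}{t^2}\right)\wedge\left(x^\top A^{-1}x\right)\right].$$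
   Context: Notation: $X$ is the $n\times p$ matrix whose $i$-th row is $X_i^\top$. $a\wedge b=\min(a,b)$; $\succeq$ is the Loewner order; $\|\cdot\|$ is the Euclidean norm. Standing assumptions: the ratio $p/n$ stays bounded away from $0$ and $\infty$; the $X_j$ are independent with mean $0$ and covariance $\Sigma_j$. For $k\ge1$, $b_L(k;X_j)$ is a deterministic number (finite for the exponents that appear) such that $\mathbb{E}|X_j^\top v|^k\le b_L(k;X_j)$ for every deterministic unit vector $v$. Without loss of generality $b_L(k;X_j)\le\sqrt{b_L(2k;X_j)}$. *)

(* Defs.v *)
From HB Require Import structures.
From mathcomp Require Import all_boot all_order all_algebra.
From mathcomp Require Import all_classical all_reals all_analysis.

Set Implicit Arguments.
Unset Strict Implicit.
Unset Printing Implicit Defensive.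

Import Order.TTheory GRing.Theory Num.Theory.

Local Open Scope classical_set_scope.
Local Open Scope ring_scope.

Section LinearAlgebra.
Context {R : realType}.

(* The library norm on matrices is the sup norm. *)
Definition enorm n (v : 'cV[R]_n) : R := Num.sqrt (\sum_i v i 0 ^+ 2).

Definition inner n (u v : 'cV[R]_n) : R := (u^T *m v) 0 0.

Definition qform n (A : 'M[R]_n) (v : 'cV[R]_n) : R := (v^T *m A *m v) 0 0.

Definition posdefmx n (A : 'M[R]_n) : Prop :=
  A^T = A /\ forall v, v != 0 -> 0 < qform A v.

Definition possemidefmx n (A : 'M[R]_n) : Prop :=
  A^T = A /\ forall v, 0 <= qform A v.

Definition loewner_ge n (A B : 'M[R]_n) : Prop := possemidefmx (A - B).

End LinearAlgebra.

(* The product rule is required over every subfamily J. *)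
Definition mutually_independent d d' (T : measurableType d)
    (U : measurableType d') (R : realType) (P : probability T R)
    (I : finType) (X : I -> T -> U) : Prop :=
  forall (J : {set I}) (B : I -> set U),
    (forall i, i \in J -> measurable (B i)) ->
    P (\bigcap_(i in [set` J]) (X i @^-1` B i)) =
    (\prod_(i in J) P (X i @^-1` B i))%E.

Section RandomVectors.
Context d (T : measurableType d) (R : realType) (P : probability T R).

(* Random vectors of R^p take values in p.-tuple R, which carries the product
   (= Borel) sigma-algebra. *)
Definition coord p (X : T -> p.-tuple R) (k : 'I_p) : T -> R :=
  fun w => tnth (X w) k.

Definition cvec p (X : T -> p.-tuple R) (w : T) : 'cV[R]_p :=
  \col_k coord X k w.

Definition centered p (X : T -> p.-tuple R) : Prop :=
  forall k, P.-integrable setT (EFin \o coord X k) /\ 'E_P[coord X k]%E = 0%E.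

Definition has_covariance p (X : T -> p.-tuple R) (S : 'M[R]_p) : Prop :=
  forall k l, coord X k \in Lfun P 2%:E /\
    covariance P (coord X k) (coord X l) = (S k l)%:E.

(* b k plays the role of b_L(k; X); the value +oo is allowed, for exponents k
   at which the moments of X may be infinite. *)
Definition moment_bound p (X : T -> p.-tuple R) (b : nat -> \bar R) : Prop :=
  forall k, (1 <= k)%N -> forall v : 'cV[R]_p, enorm v = 1 ->
    ('E_P[fun w => (`|inner (cvec X w) v| ^+ k)%R] <= b k)%E.

Definition data_mx n p (X : 'I_n -> T -> p.-tuple R) (w : T) : 'M[R]_(n, p) :=
  \matrix_(i, k) coord (X i) k w.

Definition hstat n p (X : 'I_n -> T -> p.-tuple R) (D : 'M[R]_n)
    (A : 'M[R]_p) (alpha : 'cV[R]_n) (x : 'cV[R]_p) (w : T) : R :=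
  let Xw := data_mx X w in
  (Num.sqrt n%:R)^-1 *
    (alpha^T *m D *m Xw
       *m invmx (n%:R^-1 *: (Xw^T *m (D *m D) *m Xw) + A) *m x) 0 0.

End RandomVectors.

(* Main.v *)
Require Import Defs.
From HB Require Import structures.
From mathcomp Require Import all_boot all_order all_algebra.
From mathcomp Require Import all_classical all_reals all_analysis.
From mathcomp Require Import measurable_realfun ring lra.

Set Implicit Arguments.
Unset Strict Implicit.
Unset Printing Implicit Defensive.

Import Order.TTheory GRing.Theory Num.Theory.

Local Open Scope classical_set_scope.
Local Open Scope ring_scope.

(** The proof combines an Efron-Stein bound with a rank-one perturbation
argument.

Put Y = n^(-1/2) D X and q = x^T A^-1 x, so that h = <alpha, Y z> where z
solves the regularised normal equations (Y^T Y + A) z = x.  Pairing the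
equations with z gives the energy identity <x, z> = |Y z|^2 + z^T A z, and
adding the positive term Y^T Y to A can only lower the quadratic form of the
inverse, so <x, z> <= q.  Hence h^2 <= q
pointwise ([ridge_stat_sq_le]): h is a bounded random variable, and replacing
one row changes it by at most 2 sqrt(q).

Let Y0 be Y with its i-th row u^T erased, z0 the solution of
(Y0^T Y0 + A) z0 = x and y that of (Y0^T Y0 + A) y = Y0^T alpha.  As
Y^T Y = Y0^T Y0 + u u^T, the erasure changes h by exactly
s (alpha_i - <u, y>) with s = <u, z>, and |s| <= |<u, z0>|
([ridge_remove_row]).  Neither z0 nor y depends on u, and the energy identity
yields t |z0|^2 <= q and t |y|^2 <= 1.  So, all other rows being frozen, the
squared change is at most
2 alpha_i^2 <u, z0>^2 + 2 <u, z0>^2 <u, y>^2, whose mean is controlled by the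
second and fourth moments of X_i along two fixed directions.

Finally the variance of a bounded function of independent variables is at
most the sum over i of any uniform bound on its variance in the i-th
variable, the others being frozen ([Efron_Stein]).  The induction behind it
needs only Fubini and one consequence of independence: the first variable and
the remaining ones may be sampled from two separate copies of the probability
space ([Rintegral_decouple]).  This avoids n-fold product measures and
conditional expectations altogether. *)

(** * Euclidean inner products *)

Section InnerProduct.
Context {R : realType}.

Lemma innerE n (u v : 'cV[R]_n) : inner u v = \sum_i u i 0 * v i 0.
Proof. by rewrite /inner mxE; apply: eq_bigr => i _; rewrite mxE. Qed.

Lemma innerC n (u v : 'cV[R]_n) : inner u v = inner v u.
Proof. by rewrite !innerE; apply: eq_bigr => i _; rewrite mulrC. Qed.

Lemma innerDr n (u v w : 'cV[R]_n) : inner u (v + w) = inner u v + inner u w.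
Proof. by rewrite /inner mulmxDr mxE. Qed.

Lemma innerBr n (u v w : 'cV[R]_n) : inner u (v - w) = inner u v - inner u w.
Proof. by rewrite /inner mulmxBr !mxE. Qed.

Lemma innerZr n a (u v : 'cV[R]_n) : inner u (a *: v) = a * inner u v.
Proof. by rewrite /inner -scalemxAr mxE. Qed.

Lemma innerBl n (u v w : 'cV[R]_n) : inner (u - v) w = inner u w - inner v w.
Proof. by rewrite !(innerC _ w) innerBr. Qed.

Lemma innerZl n a (u v : 'cV[R]_n) : inner (a *: u) v = a * inner u v.
Proof. by rewrite !(innerC _ v) innerZr. Qed.

Lemma inner_mull m n (M : 'M[R]_(m, n)) u v :
  inner (M *m u) v = inner u (M^T *m v).
Proof. by rewrite /inner trmx_mul mulmxA. Qed.

Lemma qformE n (A : 'M[R]_n) v : qform A v = inner v (A *m v).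
Proof. by rewrite /qform /inner mulmxA. Qed.

Lemma inner_ge0 n (u : 'cV[R]_n) : 0 <= inner u u.
Proof. by rewrite innerE sumr_ge0// => i _; rewrite -expr2 sqr_ge0. Qed.

Lemma inner_eq0 n (u : 'cV[R]_n) : inner u u = 0 -> u = 0.
Proof.
rewrite innerE => /psumr_eq0P u0; apply/colP => i; rewrite mxE.
have /u0 : forall j, true -> 0 <= u j 0 * u j 0.
  by move=> j _; rewrite -expr2 sqr_ge0.
by move=> /(_ i isT) /eqP; rewrite mulf_eq0 orbb => /eqP.
Qed.

Lemma enormE n (u : 'cV[R]_n) : enorm u = Num.sqrt (inner u u).
Proof.
by rewrite /enorm innerE; congr Num.sqrt; apply: eq_bigr => i _; rewrite expr2.
Qed.

Lemma enorm1_inner n (u : 'cV[R]_n) : enorm u = 1 -> inner u u = 1.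
Proof.
by rewrite enormE => u1; rewrite -[LHS]sqr_sqrtr ?inner_ge0// u1 expr1n.
Qed.

Lemma inner_CauchySchwarz n (u v : 'cV[R]_n) :
  inner u v ^+ 2 <= inner u u * inner v v.
Proof.
have [/inner_eq0 ->|v0] := eqVneq (inner v v) 0.
  rewrite -[0]/(0 : 'cV_n) -(scale0r (0 : 'cV[R]_n)).
  by rewrite !innerZr !mul0r mulr0 expr0n.
have vp : 0 < inner v v by rewrite lt_def v0 inner_ge0.
have := inner_ge0 (inner v v *: u - inner u v *: v).
rewrite !(innerBl, innerBr, innerZl, innerZr) (innerC v u).
set a := inner u u; set b := inner u v; set c := inner v v => h.
rewrite -subr_ge0 -(pmulr_rge0 _ vp) -/c.
by apply: le_trans h _; rewrite le_eqVlt; apply/orP; left; apply/eqP; ring.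
Qed.

End InnerProduct.

(** * Regularised normal equations and erasure of one row *)

Section RidgeRegression.
Context {R : realType} (n p : nat).
Implicit Types (Y : 'M[R]_(n, p)) (A : 'M[R]_p).

Definition ridge_mx A Y : 'M[R]_p := Y^T *m Y + A.

Definition ridge_sol A Y (v : 'cV[R]_p) : 'cV[R]_p := invmx (ridge_mx A Y) *m v.

Lemma posdefmx_unit A : posdefmx A -> A \in unitmx.
Proof.
move=> [As Ap]; rewrite unitmxE unitfE; apply/negP => /det0P[v v0 vA].
have /Ap : v^T != 0 by rewrite -trmx0 (inj_eq trmx_inj).
by rewrite /qform trmxK vA mul0mx mxE ltxx.
Qed.

Lemma qform_ridge A Y v :
  qform (ridge_mx A Y) v = inner (Y *m v) (Y *m v) + qform A v.
Proof. by rewrite !qformE mulmxDl innerDr inner_mull mulmxA. Qed.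

Variables (A : 'M[R]_p) (hA : posdefmx A).

Lemma qform_ge0 v : 0 <= qform A v.
Proof.
have [->|v0] := eqVneq v 0; last exact/ltW/hA.2.
by rewrite /qform mulmx0 mxE.
Qed.

Lemma ridge_posdef Y : posdefmx (ridge_mx A Y).
Proof.
split; first by rewrite /ridge_mx linearD/= trmx_mul trmxK hA.1.
by move=> v v0; rewrite qform_ridge ltr_wpDl ?inner_ge0// hA.2.
Qed.

Lemma ridge_sym Y u v :
  inner (ridge_mx A Y *m u) v = inner u (ridge_mx A Y *m v).
Proof. by rewrite inner_mull (ridge_posdef Y).1. Qed.

Lemma ridge_solK Y v : ridge_mx A Y *m ridge_sol A Y v = v.
Proof. by rewrite mulKVmx// posdefmx_unit//; exact: ridge_posdef. Qed.

Lemma ridge_energy Y v : let z := ridge_sol A Y v in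
  inner v z = inner (Y *m z) (Y *m z) + qform A z.
Proof. by move=> z; rewrite -qform_ridge qformE -ridge_sym ridge_solK. Qed.

(** With v = A^-1 x, expanding 0 <= (v - z)^T A (v - z) gives
2 <x, z> <= q + z^T A z, and z^T A z <= <x, z> by the energy identity. *)
Lemma ridge_energy_le Y x : inner x (ridge_sol A Y x) <= qform (invmx A) x.
Proof.
set z := ridge_sol A Y x; set v := invmx A *m x.
have Av : A *m v = x by rewrite mulKVmx// posdefmx_unit.
have := qform_ge0 (v - z).
rewrite qformE mulmxBr !(innerBl, innerBr) Av.
have -> : inner v (A *m z) = inner x z by rewrite -Av inner_mull hA.1.
have -> : qform (invmx A) x = inner v x by rewrite qformE innerC.
rewrite (innerC z x) -(qformE A z) => h.
have := ridge_energy Y x; rewrite /= -/z => e.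
have := inner_ge0 (Y *m z); lra.
Qed.

Lemma ridge_stat_sq_le Y (alpha : 'cV[R]_n) x : inner alpha alpha = 1 ->
  inner alpha (Y *m ridge_sol A Y x) ^+ 2 <= qform (invmx A) x.
Proof.
move=> a1; apply: le_trans (inner_CauchySchwarz _ _) _; rewrite a1 mul1r.
apply: le_trans (ridge_energy_le Y x).
by rewrite ridge_energy lerDl qform_ge0.
Qed.

(** The diagonal of the regularised hat matrix is at most 1: with y the solution
for Y^T alpha, expand 0 <= |alpha - Y y|^2 and bound |Y y|^2 by
<Y^T alpha, y> = <alpha, Y y>. *)
Lemma ridge_leverage_le Y (alpha : 'cV[R]_n) :
  inner (Y^T *m alpha) (ridge_sol A Y (Y^T *m alpha)) <= inner alpha alpha.
Proof.
have := ridge_energy Y (Y^T *m alpha); set y := ridge_sol _ _ _ => /=.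
have := inner_ge0 (alpha - Y *m y).
rewrite !(innerBl, innerBr) (innerC (Y *m y) alpha).
rewrite (inner_mull Y^T) trmxK.
have := qform_ge0 y; lra.
Qed.

Variables (t : R) (hAt : loewner_ge A t%:M).

Lemma qform_lower v : t * inner v v <= qform A v.
Proof.
have := hAt.2 v.
by rewrite !qformE mulmxBl innerBr mul_scalar_mx innerZr subr_ge0.
Qed.

Lemma ridge_sol_norm_le Y v :
  t * inner (ridge_sol A Y v) (ridge_sol A Y v) <= inner v (ridge_sol A Y v).
Proof.
apply: le_trans (qform_lower _) _.
by rewrite ridge_energy lerDr inner_ge0.
Qed.

(** Subtracting the equations for z and z0 gives S0 (z0 - z) = s u, where S0 is
the matrix without the row u and s = <u, z>.  Pairing this with y turns
<alpha, Y0 (z0 - z)> into s <u, y>, so that the difference of the two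
statistics is s (alpha_i - <u, y>).  Pairing it with z0 - z gives
0 <= s (<u, z0> - s), whence |s| <= |<u, z0>|: the Sherman-Morrison
denominator 1 + u^T S0^-1 u only helps. *)
Lemma ridge_remove_row Y0 (i : 'I_n) (u x : 'cV[R]_p) (alpha : 'cV[R]_n) :
  row i Y0 = 0 ->
  forall Y z0 y, Y = Y0 + delta_mx i 0 *m u^T -> z0 = ridge_sol A Y0 x ->
    y = ridge_sol A Y0 (Y0^T *m alpha) ->
  (inner alpha (Y *m ridge_sol A Y x) - inner alpha (Y0 *m z0)) ^+ 2
  <= 2 * (alpha i 0 ^+ 2 * inner u z0 ^+ 2 + inner u z0 ^+ 2 * inner u y ^+ 2).
Proof.
move=> Y0i Y z0 y defY defz0 defy.
set z := ridge_sol A Y x; pose s := inner u z.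
pose e : 'cV[R]_n := delta_mx i 0; rewrite -/e in defY.
have eY0 : e^T *m Y0 = 0 by rewrite /e trmx_delta -rowE.
have Y0e : Y0^T *m e = 0 by rewrite -[RHS]trmx0 -eY0 trmx_mul trmxK.
have ee : e^T *m e = 1%:M.
  rewrite /e trmx_delta mul_delta_mx.
  by apply/matrixP => a b; rewrite !mxE !ord1.
have uz : u^T *m z = s%:M by rewrite [LHS]mx11_scalar.
have Yz : Y *m z = Y0 *m z + s *: e.
  by rewrite defY mulmxDl -mulmxA uz mul_mx_scalar.
have S : ridge_mx A Y *m z = ridge_mx A Y0 *m z + s *: u.
  have YT : Y^T = Y0^T + u *m e^T by rewrite defY linearD/= trmx_mul trmxK.
  rewrite /ridge_mx !mulmxDl -!mulmxA Yz YT mulmxDl !mulmxDr.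
  rewrite -!mulmxA -!scalemxAr Y0e ee (mulmxA e^T) eY0 mul0mx !mulmx0.
  by rewrite scaler0 mulmx1 addr0 add0r addrAC.
have dS : ridge_mx A Y0 *m (z0 - z) = s *: u.
  rewrite mulmxBr defz0 ridge_solK -[X in X - _](ridge_solK Y x) -/z S.
  by rewrite addrC addKr.
have sa : s ^+ 2 <= inner u z0 ^+ 2.
  have : 0 <= s * (inner u z0 - s).
    rewrite -innerBr -innerZl -dS innerC -qformE qform_ridge.
    by rewrite addr_ge0 ?inner_ge0 ?qform_ge0.
  nra.
have -> : inner alpha (Y *m z) - inner alpha (Y0 *m z0)
        = s * (alpha i 0 - inner u y).
  rewrite Yz innerDr innerZr.
  have -> : inner alpha e = alpha i 0.
    rewrite innerE (bigD1 i)//= /e mxE !eqxx mulr1 big1 ?addr0// => j ji.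
    by rewrite mxE (negbTE ji) mulr0.
  have : inner alpha (Y0 *m (z0 - z)) = s * inner u y.
    have := inner_mull Y0^T alpha (z0 - z); rewrite trmxK => <-.
    rewrite -[Y0^T *m alpha](ridge_solK Y0) -defy ridge_sym dS innerZr.
    by rewrite (innerC y).
  rewrite mulmxBr innerBr => yu; lra.
rewrite exprMn.
have h2 : (alpha i 0 - inner u y) ^+ 2 <= 2 * (alpha i 0 ^+ 2 + inner u y ^+ 2).
  by have := sqr_ge0 (alpha i 0 + inner u y); nra.
apply: le_trans (ler_pM (sqr_ge0 _) (sqr_ge0 _) sa h2) _.
by rewrite le_eqVlt; apply/orP; left; apply/eqP; ring.
Qed.

End RidgeRegression.

(** * Bounded random variables and their variance *)

Section BoundedMeasurable.
Context d (T : measurableType d) (R : realType).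
Implicit Types f g : T -> R.

(** All functions integrated in the Efron-Stein argument lie in this class,
which is stable under every operation used and makes integrability, finiteness
and Fubini unconditional. *)
Definition bounded_mfun f :=
  measurable_fun [set: T] f /\ exists M, forall x, `|f x| <= M.

Lemma bounded_mfun_cst c : bounded_mfun (fun=> c).
Proof. by split; [exact: measurable_cst|exists `|c|]. Qed.

Lemma bounded_mfunD f g :
  bounded_mfun f -> bounded_mfun g -> bounded_mfun (fun x => f x + g x).
Proof.
move=> [mf [M fM]] [mg [N gN]]; split; first exact: measurable_funD.
by exists (M + N) => x; apply: le_trans (ler_normD _ _) _; exact: lerD.
Qed.

Lemma bounded_mfunM f g :
  bounded_mfun f -> bounded_mfun g -> bounded_mfun (fun x => f x * g x).
Proof.
move=> [mf [M fM]] [mg [N gN]]; split; first exact: measurable_funM.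
by exists (M * N) => x; rewrite normrM ler_pM.
Qed.

Lemma bounded_mfunB f g :
  bounded_mfun f -> bounded_mfun g -> bounded_mfun (fun x => f x - g x).
Proof.
move=> bf bg.
have := bounded_mfunD bf (bounded_mfunM (bounded_mfun_cst (-1)) bg).
by congr bounded_mfun; apply/funext => x; rewrite mulN1r.
Qed.

Lemma bounded_mfunX f n : bounded_mfun f -> bounded_mfun (fun x => f x ^+ n).
Proof.
move=> bf; elim: n => [|n IH]; first exact: bounded_mfun_cst.
by under eq_fun do rewrite exprS; exact: bounded_mfunM.
Qed.

Variable mu : probability T R.

Lemma bounded_mfun_integrable f :
  bounded_mfun f -> mu.-integrable [set: T] (EFin \o f).
Proof.
move=> [mf [M fM]]; apply: measurable_bounded_integrable => //.
  by rewrite (le_lt_trans (probability_le1 mu measurableT))// ltry.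
exists M; split; first exact: num_real.
by move=> N MN x _; exact: le_trans (fM x) (ltW MN).
Qed.

Lemma integral_probability_cst (c : R) : (\int[mu]_x c%:E = c%:E)%E.
Proof.
rewrite integral_cst// -[RHS]mule1; congr (_ * _)%E.
exact: probability_setT.
Qed.

Lemma Rintegral_probability_cst c : \int[mu]_x c = c.
Proof. by rewrite /Rintegral integral_probability_cst. Qed.

Lemma bounded_RintegralD f g : bounded_mfun f -> bounded_mfun g ->
  \int[mu]_x (f x + g x) = \int[mu]_x f x + \int[mu]_x g x.
Proof.
by move=> bf bg; rewrite RintegralD//; exact: bounded_mfun_integrable.
Qed.

Lemma bounded_RintegralB f g : bounded_mfun f -> bounded_mfun g ->
  \int[mu]_x (f x - g x) = \int[mu]_x f x - \int[mu]_x g x.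
Proof.
by move=> bf bg; rewrite RintegralB//; exact: bounded_mfun_integrable.
Qed.

Lemma bounded_RintegralZ c f : bounded_mfun f ->
  \int[mu]_x (c * f x) = c * \int[mu]_x f x.
Proof. by move=> bf; rewrite RintegralZl//; exact: bounded_mfun_integrable. Qed.

Lemma bounded_le_Rintegral f g : bounded_mfun f -> bounded_mfun g ->
  (forall x, f x <= g x) -> \int[mu]_x f x <= \int[mu]_x g x.
Proof.
by move=> bf bg fg; apply: le_Rintegral => //; exact: bounded_mfun_integrable.
Qed.

Lemma bounded_Rintegral_le f c : bounded_mfun f ->
  (forall x, f x <= c) -> \int[mu]_x f x <= c.
Proof.
move=> bf fc; rewrite -[leRHS]Rintegral_probability_cst.
by apply: bounded_le_Rintegral => //; exact: bounded_mfun_cst.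
Qed.

Lemma bounded_EFin_Rintegral f : bounded_mfun f ->
  (\int[mu]_x f x)%:E = (\int[mu]_x (f x)%:E)%E.
Proof.
move=> bf; rewrite /Rintegral fineK// integrable_fin_num//.
exact: bounded_mfun_integrable.
Qed.

Definition var f := \int[mu]_x (f x ^+ 2) - (\int[mu]_x f x) ^+ 2.

Lemma second_moment_about c f : bounded_mfun f ->
  \int[mu]_x ((f x - c) ^+ 2) = var f + (\int[mu]_x f x - c) ^+ 2.
Proof.
move=> bf; have b2 := bounded_mfunX 2 bf.
have bc := bounded_mfun_cst (c ^+ 2).
have bcf := bounded_mfunM (bounded_mfun_cst (2 * c)) bf.
rewrite (_ : (fun x => _) = fun x => f x ^+ 2 - 2 * c * f x + c ^+ 2); last first.
  by apply/funext => x; ring.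
rewrite bounded_RintegralD//; last exact: bounded_mfunB.
rewrite bounded_RintegralB// bounded_RintegralZ//.
rewrite (Rintegral_probability_cst (c ^+ 2)) /var; ring.
Qed.

Lemma varE f : bounded_mfun f ->
  \int[mu]_x ((f x - \int[mu]_y f y) ^+ 2) = var f.
Proof. by move=> bf; rewrite second_moment_about// subrr expr0n addr0. Qed.

(** This lets any constant, in particular the statistic with a row erased,
replace the mean. *)
Lemma var_le_second_moment c f : bounded_mfun f ->
  var f <= \int[mu]_x ((f x - c) ^+ 2).
Proof. by move=> bf; rewrite second_moment_about// lerDl sqr_ge0. Qed.

Lemma sqr_Rintegral_le f : bounded_mfun f ->
  (\int[mu]_x f x) ^+ 2 <= \int[mu]_x (f x ^+ 2).
Proof.
move=> bf; rewrite -subr_ge0 -/(var f) -varE//.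
by apply: Rintegral_ge0 => x _; exact: sqr_ge0.
Qed.

End BoundedMeasurable.

Lemma bounded_mfun_comp d d' (T : measurableType d) (T' : measurableType d')
    (R : realType) (h : T' -> T) (f : T -> R) :
  measurable_fun [set: T'] h -> bounded_mfun f -> bounded_mfun (f \o h).
Proof.
move=> mh [mf [M fM]]; split; first exact: measurableT_comp.
by exists M => x; exact: fM.
Qed.

Section Fubini.
Context d1 d2 (T1 : measurableType d1) (T2 : measurableType d2) (R : realType).
Variables (m1 : probability T1 R) (m2 : probability T2 R).
Variable f : T1 * T2 -> R.
Hypothesis bf : bounded_mfun f.

Lemma bounded_section1 x : bounded_mfun (fun y => f (x, y)).
Proof. exact: (bounded_mfun_comp (pair1_measurable x) bf). Qed.

Lemma bounded_section2 y : bounded_mfun (fun x => f (x, y)).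
Proof. exact: (bounded_mfun_comp (pair2_measurable y) bf). Qed.

Lemma integrable_prod : (m1 \x m2)%E.-integrable setT (EFin \o f).
Proof. exact: bounded_mfun_integrable. Qed.

Lemma bounded_Rintegral1 : bounded_mfun (fun x => \int[m2]_y f (x, y)).
Proof.
have [mf [M fM]] := bf; split.
  have := measurable_fubini_F integrable_prod.
  exact: measurableT_comp.
exists M => x.
apply: le_trans (le_normr_Rintegral measurableT
  (bounded_mfun_integrable m2 (bounded_section1 x))) _.
apply: bounded_Rintegral_le => //.
have [ms _] := bounded_section1 x.
by split; [exact: measurableT_comp|exists M => y; rewrite normr_id].
Qed.

Lemma Rintegral12_prod :
  \int[m1]_x \int[m2]_y f (x, y) = fine (\int[m1 \x m2]_z (f z)%:E)%E.
Proof.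
rewrite -(integral12_prod_meas1 integrable_prod); congr fine.
apply: eq_integral => x _; rewrite bounded_EFin_Rintegral//.
exact: bounded_section1.
Qed.

Lemma bounded_Rintegral2 : bounded_mfun (fun y => \int[m1]_x f (x, y)).
Proof.
have [mf [M fM]] := bf; split.
  have := measurable_fubini_G integrable_prod.
  exact: measurableT_comp.
exists M => y.
apply: le_trans (le_normr_Rintegral measurableT
  (bounded_mfun_integrable m1 (bounded_section2 y))) _.
apply: bounded_Rintegral_le => //.
have [ms _] := bounded_section2 y.
by split; [exact: measurableT_comp|exists M => x; rewrite normr_id].
Qed.

Lemma bounded_Fubini :
  \int[m1]_x \int[m2]_y f (x, y) = \int[m2]_y \int[m1]_x f (x, y).
Proof.
rewrite Rintegral12_prod -(integral21_prod_meas1 integrable_prod); congr fine.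
apply: eq_integral => y _; rewrite bounded_EFin_Rintegral//.
exact: bounded_section2.
Qed.

End Fubini.

(** Tensorisation of the variance.  The left-hand side splits into the mean of
the variances in y, at most c2, plus the variance of the partial mean F.  With
H y the mean of f in x, F x minus its mean is the mean over y of f (x, y) - H y;
by Jensen and Fubini the variance of F is then at most the mean over y of the
variances in x. *)
Lemma var_prod_le d1 d2 (T1 : measurableType d1) (T2 : measurableType d2)
    (R : realType) (m1 : probability T1 R) (m2 : probability T2 R)
    (f : T1 * T2 -> R) (c1 c2 : R) :
  bounded_mfun f ->
  (forall y, var m1 (fun x => f (x, y)) <= c1) ->
  (forall x, var m2 (fun y => f (x, y)) <= c2) ->
  \int[m1]_x \int[m2]_y (f (x, y) ^+ 2) - (\int[m1]_x \int[m2]_y f (x, y)) ^+ 2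
  <= c1 + c2.
Proof.
move=> bf v1 v2.
pose F x := \int[m2]_y f (x, y); pose H y := \int[m1]_x f (x, y).
have bF : bounded_mfun F by exact: bounded_Rintegral1.
have bH : bounded_mfun H by exact: bounded_Rintegral2.
have b2 := bounded_mfunX 2 bf.
have bF2 := bounded_mfunX 2 bF.
have bG : bounded_mfun (fun x => \int[m2]_y (f (x, y) ^+ 2)).
  exact: (bounded_Rintegral1 m1 m2 b2).
have var2 : \int[m1]_x (\int[m2]_y (f (x, y) ^+ 2)) - \int[m1]_x (F x ^+ 2) <= c2.
  rewrite -bounded_RintegralB//; apply: bounded_Rintegral_le; last exact: v2.
  exact: bounded_mfunB.
suff : var m1 F <= c1 by rewrite /var; lra.
rewrite -varE// bounded_Fubini//.
pose g z := f z - H z.2.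
have bg : bounded_mfun g.
  apply: bounded_mfunB => //; exact: (bounded_mfun_comp measurable_snd bH).
have bg2 := bounded_mfunX 2 bg.
apply: (@le_trans _ _ (\int[m1]_x \int[m2]_y (g (x, y) ^+ 2))).
  apply: bounded_le_Rintegral.
  - by apply: bounded_mfunX; apply: bounded_mfunB => //; exact: bounded_mfun_cst.
  - exact: (bounded_Rintegral1 m1 m2 bg2).
  - move=> x; rewrite -bounded_RintegralB//; last exact: bounded_section1.
    by apply: sqr_Rintegral_le; exact: (bounded_section1 bg).
rewrite (bounded_Fubini m1 m2 bg2); apply: bounded_Rintegral_le.
  exact: (bounded_Rintegral2 m1 m2 bg2).
move=> y; apply: le_trans (v1 y); rewrite -varE//.
exact: bounded_section2.
Qed.

(** * Independence and the Efron-Stein inequality *)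

Section Boxes.
Context d (U : measurableType d) (n : nat).

Definition box (B : 'I_n -> set U) : set (n.-tuple U) :=
  [set z | forall i, B i (tnth z i)].

Definition boxes : set (set (n.-tuple U)) :=
  [set A | exists2 B, (forall i, measurable (B i)) & A = box B].

Lemma measurable_box B : (forall i, measurable (B i)) -> measurable (box B).
Proof.
move=> mB; rewrite (_ : box B =
    \bigcap_(i in [set: 'I_n]) ((fun z => tnth z i) @^-1` B i)).
  apply: fin_bigcap_measurable => // i _; rewrite -[X in measurable X]setTI.
  exact: measurable_tnth.
by apply/seteqP; split => [z zB i _|z zB i]; exact: zB.
Qed.

Lemma tuple_measurableE : measurable = <<s boxes >>.
Proof.
apply/seteqP; split; last first.
  apply: smallest_sub; first exact: sigma_algebra_measurable.
  by move=> _ [B mB ->]; exact: measurable_box.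
apply: smallest_sub; first exact: smallest_sigma_algebra.
rewrite -bigcup_seq => A [i _ [B mB <-]]; apply: sub_sigma_algebra.
exists (fun j => if j == i then B else setT); first by move=> j; case: ifP.
rewrite setTI; apply/seteqP; split => [z Bz j|z /(_ i)]; last by rewrite eqxx.
by case: eqP => [->|].
Qed.

Lemma setI_closed_boxes : setI_closed boxes.
Proof.
move=> _ _ [A mA ->] [B mB ->]; exists (fun i => A i `&` B i).
  by move=> i; exact: measurableI.
by apply/seteqP; split => [z [zA zB] i|z zAB]; split => // i; case: (zAB i).
Qed.

Lemma box_measure_unique (R : realType)
    (m1 m2 : {measure set (n.-tuple U) -> \bar R}) :
  (forall B, (forall i, measurable (B i)) -> m1 (box B) = m2 (box B)) ->
  (m1 setT < +oo)%E -> forall A, measurable A -> m1 A = m2 A.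
Proof.
move=> m12 m1oo A mA; apply: (measure_unique boxes (fun=> setT)) => //.
- exact: tuple_measurableE.
- exact: setI_closed_boxes.
- by move=> _; exists (fun=> setT) => //; apply/seteqP; split.
- by rewrite bigcup_const.
- by move=> _ [B mB ->]; exact: m12.
Qed.

End Boxes.

Section Decoupling.
Context d d' (T : measurableType d) (U : measurableType d') (R : realType).
Variable P : probability T R.

(** The product rule over the full index set alone; unlike the rule over all
subfamilies, it passes to the tail of a family by a plain specialisation. *)
Definition box_independent n (X : 'I_n -> {mfun T >-> U}) : Prop :=
  forall B : 'I_n -> set U, (forall i, measurable (B i)) ->
  P [set w | forall i, B i (X i w)] = (\prod_(i < n) P (X i @^-1` B i))%E.

Definition joint n (X : 'I_n -> {mfun T >-> U}) (w : T) : n.-tuple U :=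
  [tuple X i w | i < n].

Lemma mutually_independent_box n (X : 'I_n -> {mfun T >-> U}) :
  mutually_independent P X -> box_independent X.
Proof.
move=> indep B mB; have := indep [set: 'I_n]%SET B (fun i _ => mB i).
rewrite (_ : \bigcap_(i in _) _ = [set w | forall i, B i (X i w)]).
  by move=> ->; apply: eq_bigl => i; rewrite inE.
by apply/seteqP; split => [w wB i|w wB i _]; apply: wB; rewrite /= inE.
Qed.

(** Take the first set of the box to be the whole space. *)
Lemma box_independent_tail n (X : 'I_n.+1 -> {mfun T >-> U}) :
  box_independent X -> box_independent (fun i => X (lift ord0 i)).
Proof.
move=> indep B mB.
pose B' i := if unlift ord0 i is Some j then B j else setT.
have mB' i : measurable (B' i) by rewrite /B'; case: unlift.
have := indep B' mB'; rewrite big_ord_recl {2}/B' unlift_none preimage_setT.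
rewrite probability_setT mul1e.
under eq_bigr do rewrite /B' liftK.
move=> <-; congr (P _); apply/seteqP; split => w wB i.
  by rewrite /B'; case: unliftP => // j ->.
by have := wB (lift ord0 i); rewrite /B' liftK.
Qed.

Lemma measurable_joint n (X : 'I_n -> {mfun T >-> U}) :
  measurable_fun [set: T] (joint X).
Proof.
apply/measurable_fun_tnthP => i.
rewrite (_ : _ \o _ = X i)//.
by apply/funext => w /=; rewrite tnth_mktuple.
Qed.

Lemma measurable_decoupled n (X : 'I_n.+1 -> {mfun T >-> U}) :
  measurable_fun [set: T * T]
   (fun z => [tuple of X ord0 z.1 :: joint (fun i => X (lift ord0 i)) z.2]).
Proof.
apply: measurable_cons; apply: measurableT_comp => //.
exact: measurable_joint.
Qed.

(** The law of the family and the law of the pair made of its head and of an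
independent copy of its tail agree on boxes, hence everywhere. *)
Lemma Rintegral_decouple n (X : 'I_n.+1 -> {mfun T >-> U})
    (f : n.+1.-tuple U -> R) :
  box_independent X -> bounded_mfun f ->
  \int[P]_w f (joint X w) =
  \int[P]_w \int[P]_w'
    f [tuple of X ord0 w :: joint (fun i => X (lift ord0 i)) w'].
Proof.
move=> indep bf.
have mX := measurable_joint X; have mD := measurable_decoupled X.
have bfD := bounded_mfun_comp mD bf.
rewrite (Rintegral12_prod P P bfD) /Rintegral; congr fine.
have mf : measurable_fun setT (EFin \o f) by apply/measurable_EFinP; case: bf.
have mP := integral_pushforward mX (mu := P) (D := setT) mf.
rewrite preimage_setT in mP; rewrite -mP//; last first.
  exact: bounded_mfun_integrable (bounded_mfun_comp mX bf).
have mPP := integral_pushforward mD (mu := (P \x P)%E) (D := setT) mf.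
rewrite preimage_setT in mPP; rewrite -mPP//; last exact: bounded_mfun_integrable.
apply: eq_measure_integral => A mA _; apply: box_measure_unique mA => //.
  move=> B mB. rewrite /= /pushforward.
  rewrite (_ : _ @^-1` _ = [set w | forall i, B i (X i w)]); last first.
    by apply/seteqP; split => w wB i; have := wB i; rewrite tnth_mktuple.
  rewrite indep// big_ord_recl -(box_independent_tail indep)//.
  rewrite -product_measure1E//; last 2 first.
    by rewrite -[X in measurable X]setTI; exact: measurable_funP.
    rewrite (_ : [set w | _] = joint (fun i => X (lift ord0 i)) @^-1`
        box (fun i => B (lift ord0 i))).
      rewrite -[X in measurable X]setTI; apply: measurable_joint => //.
      exact: measurable_box.
    by apply/seteqP; split => w wB i; have := wB i; rewrite tnth_mktuple.
  congr ((P \x P)%E _); apply/seteqP; split => [[w w']/= [w0 wB] i|[w w']/= wB].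
    by case: (unliftP ord0 i) => [j ->|->]; rewrite ?tnth0// tnthS tnth_mktuple.
  split=> /=; first by have := wB ord0; rewrite tnth0.
  by move=> i; have := wB (lift ord0 i); rewrite tnthS tnth_mktuple.
rewrite /= /pushforward preimage_setT.
by rewrite (le_lt_trans (probability_le1 P measurableT))// ltry.
Qed.

Definition tuple_set n (z : n.-tuple U) (i : 'I_n) (x : U) : n.-tuple U :=
  [tuple if j == i then x else tnth z j | j < n].

(** Decouple the head from the tail and tensorise; the variance in the tail, for
a frozen head, is bounded by induction. *)
Lemma Efron_Stein n (X : 'I_n -> {mfun T >-> U}) (f : n.-tuple U -> R)
    (C : 'I_n -> R) :
  box_independent X -> bounded_mfun f ->
  (forall i z, var P (fun w => f (tuple_set z i (X i w))) <= C i) ->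
  var P (fun w => f (joint X w)) <= \sum_(i < n) C i.
Proof.
elim: n => [|n IH] in X f C *.
  move=> _ bf _; rewrite big_ord0 /var.
  rewrite (_ : (fun w => f (joint X w)) = fun=> f [tuple]); last first.
    by apply/funext => w; rewrite [joint X w]tuple0.
  rewrite (_ : (fun w => f (joint X w) ^+ 2) = fun=> f [tuple] ^+ 2); last first.
    by apply/funext => w; rewrite [joint X w]tuple0.
  by rewrite !Rintegral_probability_cst subrr.
move=> indep bf varC; rewrite big_ord_recl /var.
rewrite (Rintegral_decouple indep (bounded_mfunX 2 bf)).
rewrite (Rintegral_decouple indep bf).
set Y := fun i => X (lift ord0 i).
have bg := bounded_mfun_comp (measurable_decoupled X) bf.
apply: (var_prod_le bg) => /= [w'|w].
  apply: le_trans (varC ord0 [tuple of X ord0 w' :: joint Y w']).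
  rewrite le_eqVlt; apply/orP; left; apply/eqP; congr var; apply/funext => w.
  congr f; apply: eq_from_tnth => i; rewrite tnth_mktuple.
  by case: (unliftP ord0 i) => [j ->|->]; rewrite ?eqxx ?tnth0// !tnthS.
apply: (IH Y (fun z => f [tuple of X ord0 w :: z])).
- exact: box_independent_tail.
- apply: (bounded_mfun_comp _ bf); apply: measurable_cons => //.
- move=> i z; apply: le_trans (varC (lift ord0 i) [tuple of X ord0 w :: z]).
  rewrite le_eqVlt; apply/orP; left; apply/eqP; congr var; apply/funext => w'.
  congr f; apply: eq_from_tnth => k; rewrite tnth_mktuple.
  case: (unliftP ord0 k) => [j ->|->]; last by rewrite !tnth0.
  by rewrite !tnthS tnth_mktuple (inj_eq lift_inj).
Qed.

End Decoupling.

(** * Measurability of the statistic *)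

Section MeasurableMatrix.
Context d (T : measurableType d) (R : realType).

Definition measurable_mx m n (M : T -> 'M[R]_(m, n)) :=
  forall i j, measurable_fun [set: T] (fun w => M w i j).

Lemma measurable_mx_cst m n (M : 'M[R]_(m, n)) : measurable_mx (fun=> M).
Proof. by move=> i j; exact: measurable_cst. Qed.

Lemma measurable_trmx m n (M : T -> 'M[R]_(m, n)) :
  measurable_mx M -> measurable_mx (fun w => (M w)^T).
Proof. by move=> mM i j; under eq_fun do rewrite mxE; exact: mM. Qed.

Lemma measurable_addmx m n (M N : T -> 'M[R]_(m, n)) :
  measurable_mx M -> measurable_mx N -> measurable_mx (fun w => M w + N w).
Proof.
by move=> mM mN i j; under eq_fun do rewrite mxE; exact: measurable_funD.
Qed.

Lemma measurable_scalemx m n (a : T -> R) (M : T -> 'M[R]_(m, n)) :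
  measurable_fun setT a -> measurable_mx M -> measurable_mx (fun w => a w *: M w).
Proof.
by move=> ma mM i j; under eq_fun do rewrite mxE; exact: measurable_funM.
Qed.

Lemma measurable_mulmx m n p (M : T -> 'M[R]_(m, n)) (N : T -> 'M[R]_(n, p)) :
  measurable_mx M -> measurable_mx N -> measurable_mx (fun w => M w *m N w).
Proof.
move=> mM mN i j; under eq_fun do rewrite mxE.
by apply: measurable_sum => k; exact: measurable_funM.
Qed.

Lemma measurable_det n (M : T -> 'M[R]_n) :
  measurable_mx M -> measurable_fun [set: T] (fun w => \det (M w)).
Proof.
move=> mM; rewrite /determinant; apply: measurable_sum => s.
apply: measurable_funM; first exact: measurable_cst.
by apply: measurable_prod => i _; exact: mM.
Qed.

Lemma measurable_adjmx n (M : T -> 'M[R]_n) :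
  measurable_mx M -> measurable_mx (fun w => \adj (M w)).
Proof.
move=> mM i j; under eq_fun do rewrite mxE /cofactor.
apply: measurable_funM; first exact: measurable_cst.
by apply: measurable_det => k l; under eq_fun do rewrite !mxE; exact: mM.
Qed.

(** Writing 1/a as a (a^2)^(-1), valid also at 0 for the total inverse, reduces
the inverse to a real power of a nonnegative quantity. *)
Lemma measurable_fun_inv (a : T -> R) :
  measurable_fun [set: T] a -> measurable_fun [set: T] (fun w => (a w)^-1).
Proof.
move=> ma; rewrite (_ : (fun w => _) = fun w => a w * (a w ^+ 2) `^ (-1)).
  apply: measurable_funM => //.
  apply: (measurableT_comp (measurable_powR _)); exact: measurable_funX.
apply/funext => w; rewrite powR_inv1 ?sqr_ge0//.
have [->|a0] := eqVneq (a w) 0; first by rewrite invr0 mul0r.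
by rewrite expr2 invfM mulrA divff// mul1r.
Qed.

Lemma measurable_invmx n (M : T -> 'M[R]_n) : (forall w, M w \in unitmx) ->
  measurable_mx M -> measurable_mx (fun w => invmx (M w)).
Proof.
move=> uM mM; rewrite /invmx; under eq_fun do rewrite uM.
apply: measurable_scalemx; last exact: measurable_adjmx.
by apply: measurable_fun_inv; exact: measurable_det.
Qed.

End MeasurableMatrix.

(** * The statistic as a function of the sample *)

Section UnitDirection.
Context {R : realType} (p : nat).

(** Moment bounds concern unit vectors; x supplies the direction when v = 0. *)
Lemma unit_direction (x v : 'cV[R]_p) : enorm x = 1 ->
  exists2 e, enorm e = 1 & v = Num.sqrt (inner v v) *: e.
Proof.
move=> x1; have [v0|v0] := eqVneq (inner v v) 0.
  by exists x => //; rewrite v0 sqrtr0 scale0r; exact: inner_eq0.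
have vp : 0 < inner v v by rewrite lt_def v0 inner_ge0.
have sv : Num.sqrt (inner v v) != 0 by rewrite gt_eqF// sqrtr_gt0.
exists ((Num.sqrt (inner v v))^-1 *: v); last first.
  by rewrite scalerA divff// scale1r.
rewrite enormE innerZl innerZr mulrA -expr2 exprVn sqr_sqrtr ?inner_ge0//.
by rewrite mulVf// sqrtr1.
Qed.

End UnitDirection.

Section Statistic.
Context {R : realType} (n p : nat).
Variables (r : 'rV[R]_n) (A : 'M[R]_p) (hA : posdefmx A).
Variables (alpha : 'cV[R]_n) (x : 'cV[R]_p).

Definition scaled_mx (X : 'M[R]_(n, p)) : 'M[R]_(n, p) :=
  (Num.sqrt n%:R)^-1 *: (diag_mx r *m X).

Lemma hstatE d (T : measurableType d) (X : 'I_n -> T -> p.-tuple R) w :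
  hstat X (diag_mx r) A alpha x w =
  inner alpha (scaled_mx (data_mx X w) *m ridge_sol A (scaled_mx (data_mx X w)) x).
Proof.
rewrite /hstat /inner /ridge_sol /ridge_mx /scaled_mx.
set Xw := data_mx X w.
have -> : ((Num.sqrt n%:R)^-1 *: (diag_mx r *m Xw))^T
          *m ((Num.sqrt n%:R)^-1 *: (diag_mx r *m Xw))
        = n%:R^-1 *: (Xw^T *m (diag_mx r *m diag_mx r) *m Xw).
  rewrite [X in X *m _]linearZ/= -scalemxAl -scalemxAr scalerA -expr2 exprVn.
  by rewrite sqr_sqrtr ?ler0n// trmx_mul tr_diag_mx !mulmxA.
by rewrite -!scalemxAl -scalemxAr [in RHS]mxE !mulmxA.
Qed.

Lemma measurable_hstat d (T : measurableType d) (X : 'I_n -> T -> p.-tuple R) :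
  (forall i, measurable_fun [set: T] (X i)) ->
  measurable_fun [set: T] (hstat X (diag_mx r) A alpha x).
Proof.
move=> mX; have mD : measurable_mx (data_mx X).
  move=> i k; under eq_fun do rewrite mxE.
  exact: (measurableT_comp (measurable_tnth k) (mX i)).
rewrite (funext (hstatE X)) /inner /ridge_sol.
have mY : measurable_mx (fun w => scaled_mx (data_mx X w)).
  apply: measurable_scalemx; first exact: measurable_cst.
  by apply: measurable_mulmx => //; exact: measurable_mx_cst.
apply: (@measurable_mulmx _ _ _ _ _ _ (fun=> alpha^T)).
  exact: measurable_mx_cst.
apply: measurable_mulmx => //.
apply: measurable_mulmx; last exact: measurable_mx_cst.
apply: measurable_invmx.
  by move=> w; apply: posdefmx_unit; exact: ridge_posdef.
apply: measurable_addmx; last exact: measurable_mx_cst.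
by apply: measurable_mulmx => //; exact: measurable_trmx.
Qed.

(** The same statistic on the space of samples, each sample being its own
realisation of the data. *)
Definition tuple_stat : n.-tuple (p.-tuple R) -> R :=
  hstat (fun i z => tnth z i) (diag_mx r) A alpha x.

Lemma hstat_joint d (T : measurableType d)
    (X : 'I_n -> {mfun T >-> p.-tuple R}) w :
  hstat X (diag_mx r) A alpha x w = tuple_stat (joint X w).
Proof.
rewrite /tuple_stat !hstatE; set Y := data_mx X w; set Y' := data_mx _ _.
suff -> : Y' = Y by [].
by apply/matrixP => i k; rewrite !mxE /Defs.coord tnth_mktuple.
Qed.

Hypothesis alpha1 : enorm alpha = 1.

Lemma tuple_stat_sq_le z : tuple_stat z ^+ 2 <= qform (invmx A) x.
Proof.
rewrite /tuple_stat hstatE; apply: ridge_stat_sq_le => //.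
exact: enorm1_inner.
Qed.

Lemma bounded_tuple_stat : bounded_mfun tuple_stat.
Proof.
split; first by apply: measurable_hstat => i; exact: measurable_tnth.
exists (1 + qform (invmx A) x) => z; have := tuple_stat_sq_le z.
rewrite -real_normK ?num_real//; have := normr_ge0 (tuple_stat z); nra.
Qed.

Definition without_row (Y : 'M[R]_(n, p)) (i : 'I_n) : 'M[R]_(n, p) :=
  \matrix_(j, k) if j == i then 0 else Y j k.

Lemma scaled_tuple_set (z : n.-tuple (p.-tuple R)) i u :
  scaled_mx (data_mx (fun i z => tnth z i) (tuple_set z i u)) =
  without_row (scaled_mx (data_mx (fun i z => tnth z i) z)) i
  + delta_mx i 0 *m (((Num.sqrt n%:R)^-1 * r 0 i) *: \col_k tnth u k)^T.
Proof.
apply/matrixP => j k; rewrite /scaled_mx !mul_diag_mx !mxE big_ord1 !mxE.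
rewrite /Defs.coord tnth_mktuple eqxx andbT; case: eqP => [->|_]; last by rewrite mul0r addr0.
by rewrite add0r mul1r mulrA.
Qed.

Lemma row_without_row Y i : row i (without_row Y i) = 0.
Proof. by apply/rowP => k; rewrite !mxE eqxx. Qed.

End Statistic.

(** * Fluctuations in one observation *)

Section ReplaceOneRow.
Context {R : realType} (n p : nat).
Variables (r : 'rV[R]_n) (A : 'M[R]_p) (t : R).
Variables (alpha : 'cV[R]_n) (x : 'cV[R]_p).
Hypotheses (hA : posdefmx A) (ht : 0 < t) (hAt : loewner_ge A t%:M).
Hypotheses (alpha1 : enorm alpha = 1) (x1 : enorm x = 1).
Let q := qform (invmx A) x.
Let f := tuple_stat r A alpha x.

(** The constant c is the statistic with row i erased, and e, e' are the
directions of z0 and y; the three depend on z and i but not on the new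
observation u.  Both c and the statistic are at most sqrt(q) in absolute value,
hence the factor 4.  In the second bound the product <v, e>^2 <v, e'>^2 is
replaced by half the sum of the fourth powers, so that only one-dimensional
moments remain. *)
Lemma tuple_stat_replace_row (z : n.-tuple (p.-tuple R)) (i : 'I_n) :
  let rho2 := n%:R^-1 * r 0 i ^+ 2 in
  exists c, (forall u, (f (tuple_set z i u) - c) ^+ 2 <= 4 * q) /\
  exists e e' : 'cV[R]_p, [/\ enorm e = 1, enorm e' = 1 &
    forall u v, v = \col_k tnth u k -> (f (tuple_set z i u) - c) ^+ 2 <=
      2 * alpha i 0 ^+ 2 * rho2 * (q / t) * inner v e ^+ 2
      + rho2 ^+ 2 * (q / t ^+ 2) * (inner v e ^+ 4 + inner v e' ^+ 4)].
Proof.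
move=> rho2.
pose Xt : 'I_n -> n.-tuple (p.-tuple R) -> p.-tuple R := fun i z => tnth z i.
pose Y0 := without_row (scaled_mx r (data_mx Xt z)) i.
pose z0 := ridge_sol A Y0 x; pose y := ridge_sol A Y0 (Y0^T *m alpha).
pose rho : R := (Num.sqrt n%:R)^-1 * r 0 i.
have rhoE : rho2 = rho ^+ 2 by rewrite /rho exprMn exprVn sqr_sqrtr ?ler0n.
have aa := enorm1_inner alpha1.
exists (inner alpha (Y0 *m z0)); split=> [u|].
  have h1 : f (tuple_set z i u) ^+ 2 <= q by exact: tuple_stat_sq_le.
  have h2 : inner alpha (Y0 *m z0) ^+ 2 <= q by exact: ridge_stat_sq_le.
  have := sqr_ge0 (f (tuple_set z i u) + inner alpha (Y0 *m z0)); nra.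
have q_ge0 : 0 <= q.
  exact: le_trans (sqr_ge0 _) (ridge_stat_sq_le hA Y0 x aa).
have [e e1 z0e] := unit_direction z0 x1.
have [e' e'1 ye] := unit_direction y x1.
have z0t : inner z0 z0 <= q / t.
  rewrite ler_pdivlMr// mulrC; apply: le_trans (ridge_energy_le hA Y0 x).
  exact: ridge_sol_norm_le.
have yt : inner y y <= t^-1.
  rewrite -[leRHS]mul1r ler_pdivlMr// mulrC -[leRHS]aa.
  exact: le_trans (ridge_sol_norm_le hA hAt _ _) (ridge_leverage_le hA _ _).
exists e, e'; split=> // u v vE.
have -> : f (tuple_set z i u) =
    inner alpha ((Y0 + delta_mx i 0 *m (rho *: v)^T) *m
    ridge_sol A (Y0 + delta_mx i 0 *m (rho *: v)^T) x).
  by rewrite /f /tuple_stat hstatE scaled_tuple_set vE.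
have Y0i : row i Y0 = 0 by exact: row_without_row.
apply: le_trans (ridge_remove_row hA (u := rho *: v) (x := x)
  (alpha := alpha) Y0i erefl erefl erefl) _.
rewrite -/Y0 -/z0 -/y rhoE; clearbody rho.
set a := inner v e; set a' := inner v e'.
set cz := inner z0 z0 in z0t z0e; set cy := inner y y in yt ye.
have cz0 : 0 <= cz by exact: inner_ge0.
have cy0 : 0 <= cy by exact: inner_ge0.
have czy : cz * cy <= q / t ^+ 2.
  by rewrite expr2 invfM mulrA; apply: ler_pM.
have -> : inner (rho *: v) z0 ^+ 2 = rho ^+ 2 * cz * a ^+ 2.
  by rewrite z0e innerZl innerZr !exprMn sqr_sqrtr// mulrA.
have -> : inner (rho *: v) y ^+ 2 = rho ^+ 2 * cy * a' ^+ 2.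
  by rewrite ye innerZl innerZr !exprMn sqr_sqrtr// mulrA.
have aa' : 2 * (a ^+ 2 * a' ^+ 2) <= a ^+ 4 + a' ^+ 4.
  by have := sqr_ge0 (a ^+ 2 - a' ^+ 2); lra.
apply: (@le_trans _ _ (2 * alpha i 0 ^+ 2 * rho ^+ 2 * cz * a ^+ 2
    + (rho ^+ 2) ^+ 2 * (cz * cy) * (2 * (a ^+ 2 * a' ^+ 2)))).
  by rewrite le_eqVlt; apply/orP; left; apply/eqP; ring.
apply: lerD.
  rewrite ler_wpM2r ?sqr_ge0// ler_wpM2l//.
  by apply: mulr_ge0; [apply: mulr_ge0 => //|]; exact: sqr_ge0.
apply: ler_pM => //.
- by apply: mulr_ge0; [exact: sqr_ge0|exact: mulr_ge0].
- by apply: mulr_ge0 => //; apply: mulr_ge0; exact: sqr_ge0.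
by rewrite ler_wpM2l// sqr_ge0.
Qed.

End ReplaceOneRow.

Section Moments.
Context d (T : measurableType d) (R : realType) (P : probability T R).

Lemma measurable_inner_cvec p (X : {mfun T >-> p.-tuple R}) (e : 'cV[R]_p) :
  measurable_fun [set: T] (fun w => inner (cvec X w) e).
Proof.
under eq_fun do rewrite innerE.
apply: measurable_sum => k; apply: measurable_funM; last exact: measurable_cst.
under eq_fun do rewrite mxE.
exact: (measurableT_comp (measurable_tnth k) (measurable_funPT X)).
Qed.

Lemma moment_even p (X : {mfun T >-> p.-tuple R}) (b : nat -> \bar R) k e :
  moment_bound P X b -> (0 < k)%N -> ~~ odd k -> b k \is a fin_num ->
  enorm e = 1 ->
  (\int[P]_w (inner (cvec X w) e ^+ k)%:E <= (fine (b k))%:E)%E.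
Proof.
move=> hb k0 kev bfin e1; rewrite fineK//; have := hb k k0 e e1.
rewrite unlock; congr (_ <= _)%E; apply: eq_integral => w _; congr EFin.
by rewrite -normrX ger0_norm// exprn_even_ge0.
Qed.

End Moments.

Theorem theorem3p5 (R : realType) :
  exists K : R,
  forall (d : measure_display) (T : measurableType d) (P : probability T R)
    (n p : nat) (c1 c2 : R)
    (hc1 : 0 < c1) (hratio1 : c1 <= p%:R / n%:R) (hratio2 : p%:R / n%:R <= c2)
    (X : 'I_n -> {mfun T >-> p.-tuple R})
    (Sigma : 'I_n -> 'M[R]_p) (b : 'I_n -> nat -> \bar R)
    (hindep : mutually_independent P X)
    (hmean : forall j, centered P (X j))
    (hcov : forall j, has_covariance P (X j) (Sigma j))
    (hb : forall j, moment_bound P (X j) (b j))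
    (hb2 : forall j, b j 2%N \is a fin_num)
    (hb4 : forall j, b j 4%N \is a fin_num)
    (hbmono : forall j k, (1 <= k)%N -> (b j k <= sqrte (b j (2 * k)%N))%E)
    (r : 'rV[R]_n) (hr : forall i, 0 < r 0 i)
    (A : 'M[R]_p) (t : R) (hA : posdefmx A) (ht : 0 < t)
    (hAt : loewner_ge A t%:M)
    (alpha : 'cV[R]_n) (x : 'cV[R]_p)
    (halpha : enorm alpha = 1) (hx : enorm x = 1),
  let h := hstat X (diag_mx r) A alpha x in
  let q := qform (invmx A) x in
  ('E_P[fun w => ((h w - fine 'E_P[h]) ^+ 2)%R] <=
   (K * \sum_(i < n)
      Num.min
        (n%:R^-1 * alpha i 0 ^+ 2 * r 0 i ^+ 2 * fine (b i 2%N) * (q / t)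
         + (n%:R ^+ 2)^-1 * r 0 i ^+ 4 * fine (b i 4%N) * (q / t ^+ 2))
        q)%:E)%E.
Proof.
exists 4 => d T P n p c1 c2 _ _ _ X Sigma b hindep _ _ hb hb2 hb4 _ r _ A t hA ht
  hAt alpha x halpha hx.
set h := hstat _ _ _ _ _; set q := qform _ _; rewrite /=.
pose f := tuple_stat r A alpha x.
have bf : bounded_mfun f by exact: bounded_tuple_stat.
have hE : h = fun w => f (joint X w) by apply/funext => w; exact: hstat_joint.
have bh : bounded_mfun h.
  by rewrite hE; exact: (bounded_mfun_comp (measurable_joint X) bf).
have -> : 'E_P[fun w => ((h w - fine 'E_P[h]) ^+ 2)%R]%E = (var P h)%:E.
  rewrite unlock -varE// bounded_EFin_Rintegral//.
  by apply: bounded_mfunX; apply: bounded_mfunB => //; exact: bounded_mfun_cst.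
rewrite lee_fin hE mulr_sumr; apply: Efron_Stein => // [|i z].
  exact: mutually_independent_box.
have [c [le4q [e [e' [e1 e'1 le_moments]]]]] :=
  tuple_stat_replace_row r hA ht hAt halpha hx z i.
set g := fun w => _.
have bg : bounded_mfun g.
  apply: (bounded_mfun_comp _ bf); apply/measurable_fun_tnthP => j.
  rewrite (_ : _ \o _ = if j == i then X i : T -> _ else fun=> tnth z j).
    by case: ifP.
  by apply/funext => w /=; rewrite tnth_mktuple; case: ifP.
apply: le_trans (var_le_second_moment P c bg) _.
have bgc : bounded_mfun (fun w => (g w - c) ^+ 2).
  by apply: bounded_mfunX; apply: bounded_mfunB => //; exact: bounded_mfun_cst.
have le_q : \int[P]_w ((g w - c) ^+ 2) <= 4 * q.
  by apply: bounded_Rintegral_le => // w; exact: le4q.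
(* The trivial bound 4 q settles the case where q is the minimum. *)
rewrite minElt; case: ifP => // _.
have q_ge0 : 0 <= q.
  by apply: le_trans (sqr_ge0 (f z)) _; exact: tuple_stat_sq_le.
pose a1 := 2 * alpha i 0 ^+ 2 * (n%:R^-1 * r 0 i ^+ 2) * (q / t).
pose a2 := (n%:R^-1 * r 0 i ^+ 2) ^+ 2 * (q / t ^+ 2).
have rho2_ge0 : 0 <= n%:R^-1 * r 0 i ^+ 2.
  by rewrite mulr_ge0 ?invr_ge0 ?ler0n ?sqr_ge0.
have a1_ge0 : 0 <= a1.
  apply: mulr_ge0; last by rewrite divr_ge0// ltW.
  by apply: mulr_ge0 => //; apply: mulr_ge0 => //; exact: sqr_ge0.
have a2_ge0 : 0 <= a2 by rewrite mulr_ge0 ?sqr_ge0// divr_ge0 ?sqr_ge0.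
have m2 := moment_even (hb i) (isT : 0 < 2)%N isT (hb2 i) e1.
have m4 := moment_even (hb i) (isT : 0 < 4)%N isT (hb4 i) e1.
have m4' := moment_even (hb i) (isT : 0 < 4)%N isT (hb4 i) e'1.
have ms k v : measurable_fun setT (fun w => (inner (cvec (X i) w) v ^+ k)%:E).
  by apply/measurable_EFinP; apply: measurable_funX; exact: measurable_inner_cvec.
have ge0 k v w : (0 <= (inner (cvec (X i) w) v ^+ (2 * k))%:E)%E.
  by rewrite lee_fin exprM exprn_ge0// sqr_ge0.
have b2_ge0 : 0 <= fine (b i 2%N).
  rewrite -lee_fin; apply: le_trans m2.
  by apply: integral_ge0 => w _; exact: (ge0 1%N).
have b4_ge0 : 0 <= fine (b i 4%N).
  rewrite -lee_fin; apply: le_trans m4.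
  by apply: integral_ge0 => w _; exact: (ge0 2%N).
apply: (@le_trans _ _
  (a1 * fine (b i 2%N) + a2 * (fine (b i 4%N) + fine (b i 4%N)))).
  rewrite -lee_fin bounded_EFin_Rintegral//.
  apply: (@le_trans _ _ (\int[P]_w (a1%:E * (inner (cvec (X i) w) e ^+ 2)%:E
     + a2%:E * ((inner (cvec (X i) w) e ^+ 4)%:E
               + (inner (cvec (X i) w) e' ^+ 4)%:E)))%E).
    apply: ge0_le_integral => //.
    - by move=> w _; rewrite lee_fin sqr_ge0.
    - by apply/measurable_EFinP; case: bgc.
    - apply: emeasurable_funD; apply: emeasurable_funM => //.
      exact: emeasurable_funD.
    - by move=> w _; exact: (le_moments (X i w) (cvec (X i) w) erefl).
  rewrite ge0_integralD//; last 4 first.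
  - by move=> w _; rewrite mule_ge0// (ge0 1%N).
  - exact: emeasurable_funM.
  - by move=> w _; rewrite mule_ge0// adde_ge0// (ge0 2%N).
  - by apply: emeasurable_funM => //; exact: emeasurable_funD.
  rewrite ge0_integralZl//; last by move=> w _; exact: (ge0 1%N).
  rewrite ge0_integralZl//; last 2 first.
  - exact: emeasurable_funD.
  - by move=> w _; rewrite adde_ge0// (ge0 2%N).
  rewrite ge0_integralD//; last 2 first.
  - by move=> w _; exact: (ge0 2%N).
  - by move=> w _; exact: (ge0 2%N).
  rewrite EFinD !EFinM; apply: leeD; apply: lee_wpmul2l => //.
  by rewrite EFinD; exact: leeD.
have := mulr_ge0 a1_ge0 b2_ge0; have := mulr_ge0 a2_ge0 b4_ge0.
rewrite /a1 /a2 exprMn exprVn -exprM; nra.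
Qed.
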